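(* For every integer $n\geq 2$, $$a_n(4312,4321;213)=a_n(3421,4321;312)=2^{n-2}.$$
   Context: A permutation $\pi$ of $[n]=\{1,\dots,n\}$ is cyclic if it consists of a single $n$-cycle. Its one-line notation is $\pi_1\pi_2\cdots\pi_n$ with $\pi_i=\pi(i)$. Its standard cycle form is $(c_1,c_2,\dots,c_n)$ with $c_1=1$ and $c_{i+1}=\pi(c_i)$ for $1\le i<n$. A sequence $w_1\cdots w_n$ of distinct integers contains a pattern $\sigma=\sigma_1\cdots\sigma_k\in S_k$ if there are indices $i_1<\dots<i_k$ with $w_{i_s}>w_{i_t}$ iff $\sigma_s>\sigma_t$ for all $s<t$; otherwise it avoids $\sigma$. $\mathcal{A}_n(\sigma_1,\dots,\sigma_l;\rho)$ is the set of cyclic permutations of $[n]$ whose one-line notation avoids each $\sigma_i$ and whose standard cycle form $c_1\cdots c_n$, read as a sequence, avoids $\rho$; $a_n(\sigma_1,\dots,\sigma_l;\rho)$ is its cardinality. *)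

(* Defs.v *)
From mathcomp Require Import all_boot all_fingroup.

Set Implicit Arguments.
Unset Strict Implicit.
Unset Printing Implicit Defensive.

(* A permutation of [n] = {1, ..., n} is represented by s : 'S_n, the ordinal
   i : 'I_n standing for the integer i + 1; one_line and cycle_form below
   give the integers themselves. *)

Definition cyclic_perm (n : nat) (s : 'S_n) : bool := #|porbits s| == 1.

Definition one_line (n : nat) (s : 'S_n) : seq nat :=
  [seq (s i).+1 | i <- enum 'I_n].

(* (c_1, ..., c_n) with c_1 = 1 and c_(i+1) = s (c_i); empty when n = 0. *)
Definition cycle_form (n : nat) : 'S_n -> seq nat :=
  if n is m.+1 return 'S_n -> seq nat then
    fun s : 'S_m.+1 => [seq i.+1 | i : 'I_m.+1 <- traject s ord0 m.+1]
  else fun=> [::].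

(* f s is the position i_s in w of the s-th letter of the occurrence of p. *)
Definition contains (w p : seq nat) : bool :=
  [exists f : {ffun 'I_(size p) -> 'I_(size w)},
    [forall s : 'I_(size p), forall t : 'I_(size p),
      (s < t) ==>
        (f s < f t) &&
        ((nth 0 w (f s) > nth 0 w (f t)) == (nth 0 p s > nth 0 p t))]].

Definition avoids (w p : seq nat) : bool := ~~ contains w p.

Definition Aset (n : nat) (sigmas : seq (seq nat)) (rho : seq nat) : {set 'S_n} :=
  [set s : 'S_n | [&& cyclic_perm s,
                      all (avoids (one_line s)) sigmas
                    & avoids (cycle_form s) rho]].

Definition a_ (n : nat) (sigmas : seq (seq nat)) (rho : seq nat) : nat :=
  #|Aset n sigmas rho|.

(* Main.v *)
Require Import Defs.
From mathcomp Require Import all_boot all_fingroup.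
From mathcomp Require Import zify.

Set Implicit Arguments.
Unset Strict Implicit.
Unset Printing Implicit Defensive.

(** Inversion exchanges the two classes: it exchanges 4312 and 3421, fixes 4321,
    and reverses the cycle form after its initial 1, a letter which can occur
    neither in a 213 nor in a 312.

    For the first class, the cycle forms that occur are exactly the unimodal
    ones (increasing up to n, then decreasing).  A unimodal cycle form is
    determined by the set of letters on its increasing side before n, which
    contains 1 and is otherwise an arbitrary subset of {2, ..., n - 1}. *)

(** * Pattern containment in terms of plain positions *)

Lemma containsP (w p : seq nat) :
  contains w p <-> exists g : nat -> nat,
    (forall s, s < size p -> g s < size w) /\
    (forall s t, s < t < size p -> g s < g t /\
       (nth 0 w (g t) < nth 0 w (g s)) = (nth 0 p t < nth 0 p s)).
Proof.
split=> [/existsP[f /forallP Hf] | [g [Hw Hg]]].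
  (* The value 0 beyond the length of [p] is a default that is never consulted. *)
  exists (fun s => if insub s is Some o then f o : nat else 0).
  split=> [s sp | s t /andP[st tp]]; first by rewrite insubT.
  have sp := ltn_trans st tp; rewrite !insubT /=.
  move/forallP: (Hf (Ordinal sp)) => /(_ (Ordinal tp)) /=.
  by rewrite st /= => /andP[-> /eqP->].
apply/existsP; exists [ffun s => Ordinal (Hw _ (ltn_ord s))].
apply/forallP=> s; apply/forallP=> t; apply/implyP=> st; rewrite !ffunE /=.
by have [|-> ->] := Hg s t; rewrite ?st ?ltn_ord ?eqxx.
Qed.

Lemma contains3P (w : seq nat) (a b c : nat) :
  contains w [:: a; b; c] <->
  exists i j k, [/\ i < j, j < k, k < size w &
    [/\ (nth 0 w j < nth 0 w i) = (b < a), (nth 0 w k < nth 0 w i) = (c < a)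
      & (nth 0 w k < nth 0 w j) = (c < b)]].
Proof.
split=> [/containsP[g [Hw Hg]] | [i [j [k [ij jk kw [E1 E2 E3]]]]]].
  have [//|g01 e01] := Hg 0 1; have [//|_ e02] := Hg 0 2.
  have [//|g12 e12] := Hg 1 2.
  by exists (g 0), (g 1), (g 2); split=> //; apply: Hw.
apply/containsP; exists (nth 0 [:: i; j; k]); split.
  by case=> [|[|[|?]]] //= _; lia.
by case=> [|[|[|?]]] [|[|[|?]]] //= ?; split=> //; lia.
Qed.

Lemma contains4P (w : seq nat) (a b c d : nat) :
  contains w [:: a; b; c; d] <->
  exists i j k l, [/\ i < j, j < k, k < l, l < size w &
    [/\ (nth 0 w j < nth 0 w i) = (b < a), (nth 0 w k < nth 0 w i) = (c < a)
      & (nth 0 w k < nth 0 w j) = (c < b)] /\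
    [/\ (nth 0 w l < nth 0 w i) = (d < a), (nth 0 w l < nth 0 w j) = (d < b)
      & (nth 0 w l < nth 0 w k) = (d < c)]].
Proof.
split=> [/containsP[g [Hw Hg]]|
         [i [j [k [l [ij jk kl lw [[E1 E2 E3] [E4 E5 E6]]]]]]]].
  have [//|g01 e01] := Hg 0 1; have [//|_ e02] := Hg 0 2.
  have [//|_ e03] := Hg 0 3; have [//|g12 e12] := Hg 1 2.
  have [//|_ e13] := Hg 1 3; have [//|g23 e23] := Hg 2 3.
  by exists (g 0), (g 1), (g 2), (g 3); split=> //; apply: Hw.
apply/containsP; exists (nth 0 [:: i; j; k; l]); split.
  by case=> [|[|[|[|?]]]] //= _; lia.
by case=> [|[|[|[|?]]]] [|[|[|[|?]]]] //= ?; split=> //; lia.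
Qed.

(** * The cycle form as the orbit of the least letter *)

Section CycleForm.

Variables (m : nat) (s : 'S_m.+1).

Lemma nth_one_line (x : 'I_m.+1) : nth 0 (one_line s) x = (s x).+1.
Proof.
by rewrite (nth_map ord0) ?size_enum_ord ?ltn_ord // nth_ord_enum.
Qed.

Lemma size_one_line : size (one_line s) = m.+1.
Proof. by rewrite size_map size_enum_ord. Qed.

(** The letter at index [i] of the cycle form, lowered by one. The index is unbounded so as to reach
    [m.+1], where the cycle closes up. *)
Definition orb (i : nat) : 'I_m.+1 := iter i s ord0.

Lemma nth_cycle_form i : i < m.+1 -> nth 0 (cycle_form s) i = (orb i).+1.
Proof.
by move=> im; rewrite (nth_map ord0) ?size_traject // nth_traject.
Qed.

Lemma size_cycle_form : size (cycle_form s) = m.+1.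
Proof. by rewrite size_map size_traject. Qed.

Lemma orbS i : orb i.+1 = s (orb i). Proof. by []. Qed.

Lemma iter_orb i j : iter i s (orb j) = orb (i + j).
Proof. by rewrite /orb iterD. Qed.

Hypothesis cyc : cyclic_perm s.

Lemma porbit_cyclic x : porbit s x = [set: 'I_m.+1].
Proof.
case/cards1P: cyc => B HB; apply/setP=> y; rewrite inE.
have := imset_f (porbit s) (x := x) isT; have := imset_f (porbit s) (x := y) isT.
rewrite -/(porbits s) HB !inE => /eqP <- /eqP ->.
exact: porbit_id.
Qed.

Lemma card_porbit_cyclic x : #|porbit s x| = m.+1.
Proof. by rewrite porbit_cyclic cardsT card_ord. Qed.

Lemma orb_period : orb m.+1 = ord0.
Proof. by have := iter_porbit s ord0; rewrite card_porbit_cyclic. Qed.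

Lemma orb_inj i j : i < m.+1 -> j < m.+1 -> orb i = orb j :> nat -> i = j.
Proof.
move=> im jm /val_inj E.
have := uniq_traject_porbit s ord0; rewrite card_porbit_cyclic => U.
by apply/eqP; rewrite -(nth_uniq ord0 _ _ U) ?size_traject // !nth_traject //; apply/eqP.
Qed.

Lemma orb_surj x : exists2 i, i < m.+1 & x = orb i.
Proof.
have := porbit_traject s ord0 x; rewrite card_porbit_cyclic porbit_cyclic inE.
by move/esym/trajectP.
Qed.

Lemma orb_gt0 i : 0 < i < m.+1 -> 0 < orb i.
Proof.
move=> /andP[i0 im]; rewrite lt0n; apply/eqP=> E.
by have := @orb_inj i 0 im isT E; lia.
Qed.

End CycleForm.

(** * Inversion, and the forbidden patterns as inequalities *)

Lemma orbV (m : nat) (s : 'S_m.+1) i : cyclic_perm s -> i <= m.+1 ->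
  orb s^-1 i = orb s (m.+1 - i).
Proof.
(* The inverse runs through the cycle backwards from index [m.+1], where the cycle is back at
   [ord0]. *)
move=> cyc; elim: i => [|i IH] im; first by rewrite subn0 orb_period.
by rewrite orbS IH 1?ltnW // subSn // orbS permK subSS.
Qed.

Lemma cyclic_permV n (s : 'S_n) : cyclic_perm s^-1 = cyclic_perm s.
Proof. by rewrite /cyclic_perm porbitsV. Qed.

(** The two patterns differ only in the order of their last two letters, so [s z] and [s t] stay
    uncompared. The next definition does the same with the first two letters. *)
Definition has_4312_or_4321 n (s : 'S_n) := exists x y z t : 'I_n,
  [/\ x < y, y < z, z < t, s y < s x & s z < s y /\ s t < s y].

Definition has_3421_or_4321 n (s : 'S_n) := exists x y z t : 'I_n,
  [/\ x < y, y < z, z < t, s t < s z & s z < s x /\ s z < s y].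

Definition orb_213 m (s : 'S_m.+1) := exists i j k,
  [/\ i < j, j < k, k < m.+1, orb s j < orb s i & orb s i < orb s k].

Definition orb_312 m (s : 'S_m.+1) := exists i j k,
  [/\ i < j, j < k, k < m.+1, orb s j < orb s k & orb s k < orb s i].

(** Inversion exchanges positions and values. The two uncompared values become positions, hence the
    case split on their order. *)
Lemma has_3421V n (s : 'S_n) : has_3421_or_4321 s^-1 <-> has_4312_or_4321 s.
Proof.
split=> - [x [y [z [t [xy yz zt H1 [H2 H3]]]]]].
  have [xy'|xy'|/val_inj/perm_inj e] := ltngtP (s^-1%g x) (s^-1%g y);
    last by rewrite e ltnn in xy.
    by exists (s^-1 t)%g, (s^-1 z)%g, (s^-1 x)%g, (s^-1 y)%g; rewrite !permKV; split=> //; lia.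
  by exists (s^-1 t)%g, (s^-1 z)%g, (s^-1 y)%g, (s^-1 x)%g; rewrite !permKV; split=> //; lia.
have [e|e|/val_inj/perm_inj e] := ltngtP (s z) (s t);
  last by rewrite e ltnn in zt.
  by exists (s z), (s t), (s y), (s x); rewrite !permK; split=> //; lia.
by exists (s t), (s z), (s y), (s x); rewrite !permK; split=> //; lia.
Qed.

Lemma orb_312V m (s : 'S_m.+1) : cyclic_perm s -> orb_312 s^-1 <-> orb_213 s.
Proof.
move=> cyc; split=> - [i [j [k [ij jk km H1 H2]]]]; last first.
  (* Index 0 would be reflected to [m.+1], out of range; it carries the least letter, which cannot
     begin either pattern. *)
  have i0 : 0 < i by case: i ij H1 {H2} => // _; rewrite ltn0.
  exists (m.+1 - k), (m.+1 - j), (m.+1 - i).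
  by rewrite !orbV ?leq_subr // !subKn; try lia; split=> //; lia.
have i0 : 0 < i by case: i ij H1 H2 => // _ _; rewrite ltn0.
by exists (m.+1 - k), (m.+1 - j), (m.+1 - i); rewrite -!orbV //; try lia; split=> //; lia.
Qed.

Lemma contains_213E m (s : 'S_m.+1) : cyclic_perm s ->
  contains (cycle_form s) [:: 2; 1; 3] <-> orb_213 s.
Proof.
move=> cyc; split=> [/contains3P|] [i [j [k []]]] ij jk.
  rewrite size_cycle_form => km; rewrite !nth_cycle_form; try lia.
  (* For the pair [i], [k] the pattern only denies the reverse inequality; distinctness of the
     letters makes it strict. *)
  case=> H1 H2 H3; have ne : orb s i <> orb s k :> nat.
    by move/(orb_inj cyc (ltn_trans (ltn_trans ij jk) km) km); lia.
  by exists i, j, k; split=> //; lia.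
move=> km H1 H2; apply/contains3P; exists i, j, k.
by rewrite size_cycle_form !nth_cycle_form; try lia; split=> //; split; lia.
Qed.

Lemma contains_312E m (s : 'S_m.+1) : cyclic_perm s ->
  contains (cycle_form s) [:: 3; 1; 2] <-> orb_312 s.
Proof.
move=> cyc; split=> [/contains3P|] [i [j [k []]]] ij jk.
  rewrite size_cycle_form => km; rewrite !nth_cycle_form; try lia.
  case=> H1 H2 H3; have ne : orb s j <> orb s k :> nat.
    by move/(orb_inj cyc (ltn_trans jk km) km); lia.
  by exists i, j, k; split=> //; lia.
move=> km H1 H2; apply/contains3P; exists i, j, k.
by rewrite size_cycle_form !nth_cycle_form; try lia; split=> //; split; lia.
Qed.

Lemma contains_one_line4P m (s : 'S_m.+1) (a b c d : nat) :
  contains (one_line s) [:: a; b; c; d] <->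
  exists x y z t : 'I_m.+1, [/\ x < y, y < z, z < t &
    [/\ (s y < s x) = (b < a), (s z < s x) = (c < a) & (s z < s y) = (c < b)] /\
    [/\ (s t < s x) = (d < a), (s t < s y) = (d < b) & (s t < s z) = (d < c)]].
Proof.
split=> [/contains4P [i [j [k [l [ij jk kl]]]]] | [x [y [z [t [xy yz zt H]]]]]].
  rewrite size_one_line => lm H.
  have km := ltn_trans kl lm; have jm := ltn_trans jk km.
  have im := ltn_trans ij jm.
  exists (Ordinal im), (Ordinal jm), (Ordinal km), (Ordinal lm); split=> //.
  move: (nth_one_line s (Ordinal im)) (nth_one_line s (Ordinal jm)).
  move: (nth_one_line s (Ordinal km)) (nth_one_line s (Ordinal lm)) => /=.
  by move=> Ek El Ei Ej; move: H; rewrite Ei Ej Ek El.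
apply/contains4P; exists x, y, z, t.
by rewrite size_one_line !nth_one_line; split.
Qed.

Lemma contains_4312E m (s : 'S_m.+1) :
  contains (one_line s) [:: 4; 3; 1; 2] \/ contains (one_line s) [:: 4; 3; 2; 1]
  <-> has_4312_or_4321 s.
Proof.
rewrite !contains_one_line4P; split.
  by case=> - [x [y [z [t [xy yz zt [[H1 H2 H3] [H4 H5 H6]]]]]]];
    exists x, y, z, t; split=> //; lia.
case=> x [y [z [t [xy yz zt H1 [H2 H3]]]]].
have [e|e|/val_inj/perm_inj e] := ltngtP (s z) (s t);
  last by rewrite e ltnn in zt.
  by left; exists x, y, z, t; split=> //; split; split; lia.
by right; exists x, y, z, t; split=> //; split; split; lia.
Qed.

Lemma contains_3421E m (s : 'S_m.+1) :
  contains (one_line s) [:: 3; 4; 2; 1] \/ contains (one_line s) [:: 4; 3; 2; 1]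
  <-> has_3421_or_4321 s.
Proof.
rewrite !contains_one_line4P; split.
  by case=> - [x [y [z [t [xy yz zt [[H1 H2 H3] [H4 H5 H6]]]]]]];
    exists x, y, z, t; split=> //; lia.
case=> x [y [z [t [xy yz zt H1 [H2 H3]]]]].
have [e|e|/val_inj/perm_inj e] := ltngtP (s x) (s y);
  last by rewrite e ltnn in xy.
  by left; exists x, y, z, t; split=> //; split; split; lia.
by right; exists x, y, z, t; split=> //; split; split; lia.
Qed.

(** * Avoidance is equivalent to unimodality of the cycle form *)

Lemma crossing (P : pred nat) i j : i <= j -> ~~ P i -> P j ->
  exists k, [/\ i <= k, k < j, ~~ P k & P k.+1].
Proof.
elim: j => [|j IH] ij Pi Pj.
  by move: ij Pi; rewrite leqn0 => /eqP ->; rewrite Pj.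
have [Pj'|Pj'] := boolP (P j); last first.
  by exists j; split=> //; case: ltngtP ij => // e; rewrite e Pj in Pi.
have ij' : i <= j by case: ltngtP ij => // e; rewrite e Pj in Pi.
by have [k [? ? ? ?]] := IH ij' Pi Pj'; exists k; split=> //; lia.
Qed.

(* The lowest letter y of the cycle form between the "3" and the "2" is a
   valley.  The cycle passes from below y to above y before reaching y, and back
   below y after leaving it; these two steps, with the two at y, form the
   forbidden pattern in one-line notation. *)
Lemma orb_312_has_4312 m (s : 'S_m.+1) : cyclic_perm s -> ~ orb_213 s ->
  orb_312 s -> has_4312_or_4321 s.
Proof.
move=> cyc no213 [a [b0 [d [ab bd dm H1 H2]]]].
have Hb0 : a < b0 < d by lia.
have [b [/andP[ab' bd'] bmin]] : exists b, a < b < d /\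
    forall j, a < j < d -> orb s b <= orb s j.
  have b0m : b0 < m.+1 by lia.
  case: (@arg_minnP _ (Ordinal b0m) (fun i : 'I_m.+1 => a < i < d)
           (fun i : 'I_m.+1 => orb s i : nat) Hb0) => b Hb bmin.
  exists b; split=> // j Hj; have jm : j < m.+1 by lia.
  exact: (bmin (Ordinal jm)).
have lt_bb0 := bmin _ Hb0.
have neq i j : i < m.+1 -> j < m.+1 -> i != j -> orb s i <> orb s j :> nat.
  by move=> im jm ij /(orb_inj cyc im jm) e; rewrite e eqxx in ij.
have bm : b < m.+1 by lia.
have b'm : b.-1 < m.+1 by lia.
have bm' : b.+1 < m.+1 by lia.
have pred_b : orb s b < orb s b.-1.
  have [e|ne] := eqVneq a b.-1; first by rewrite -e; lia.
  have := bmin b.-1; have := neq b b.-1 bm b'm; lia.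
have succ_b : orb s b < orb s b.+1.
  have [e|ne] := eqVneq d b.+1; first by rewrite -e; lia.
  have := bmin b.+1; have := neq b b.+1 bm bm'; lia.
have b_gt0 : 0 < orb s b by apply: orb_gt0 => //; lia.
(* The upward passage, from index [p] to [p.+1]: the cycle starts at the letter 0, below [orb s b],
   and is above it at [b.-1]. *)
have [p [_ pb]] := @crossing (fun k => orb s b < orb s k) 0 b.-1
  (leq0n _) isT pred_b.
rewrite -leqNgt => lep gtp.
(* The downward passage, from [q] to [q.+1]; it exists because the cycle closes up at 0, so [q.+1]
   may be [m.+1]. *)
have [||q [bq qm]] := @crossing (fun k => orb s k < orb s b) b.+1 m.+1 (ltnW bm').
- by rewrite -leqNgt ltnW.
- by rewrite orb_period.
rewrite -leqNgt => geq ltq.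
(* Otherwise the letters at [p.+1], [b], [b.+1] form a 213. *)
have big_p : orb s b.+1 < orb s p.+1.
  have ne := neq p.+1 b.+1; rewrite ltnNge; apply/negP=> le.
  by apply: no213; exists p.+1, b, b.+1; split=> //; lia.
have nep := neq p b; have neq_qb := neq q b.
have predb : b.-1.+1 = b by lia.
(* The letters at [p], [b], [b.-1], [q] serve as positions and those at [p.+1], [b.+1], [b], [q.+1]
   as values; only the order of the last two positions is open. *)
have [lt|lt|e] := ltngtP (orb s b.-1) (orb s q).
- exists (orb s p), (orb s b), (orb s b.-1), (orb s q).
  by rewrite -!orbS predb; split=> //; lia.
- exists (orb s p), (orb s b), (orb s q), (orb s b.-1).
  by rewrite -!orbS predb; split=> //; lia.
- by have := orb_inj cyc b'm qm e; lia.
Qed.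

Definition unimodal_at m (s : 'S_m.+1) p := [/\ p < m.+1,
  forall i j, i < j -> j <= p -> orb s i < orb s j &
  forall i j, p <= i -> i < j -> j < m.+1 -> orb s j < orb s i].

(** The peak is the index of the largest letter. That letter would complete a descending pair before
    it to a 213, and an ascending pair after it to a 312. *)
Lemma avoiding_unimodal m (s : 'S_m.+1) : cyclic_perm s ->
  ~ has_4312_or_4321 s -> ~ orb_213 s -> exists p, unimodal_at s p.
Proof.
move=> cyc no43 no213.
have no312 : ~ orb_312 s by move/(orb_312_has_4312 cyc no213).
have [p pm Ep] := orb_surj cyc ord_max.
have le_p i : i < m.+1 -> i != p -> orb s i < orb s p.
  move=> im ip; have := ltn_ord (orb s i); rewrite -Ep ltnS leq_eqVlt.
  case/orP=> // /eqP e; have := orb_inj cyc im pm; rewrite -Ep => /(_ e) e'.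
  by rewrite e' eqxx in ip.
exists p; split=> // i j.
  move=> ij jp; rewrite ltnNge; apply/negP=> le.
  have ne : orb s i <> orb s j :> nat by move/(orb_inj cyc); lia.
  have jp' : j != p.
    by apply/eqP=> e; have := le_p i; rewrite -e; lia.
  apply: no213; exists i, j, p; split=> //; try lia.
  by apply: le_p; lia.
move=> pi ij jm; rewrite ltnNge; apply/negP=> le.
have ne : orb s i <> orb s j :> nat by move/(orb_inj cyc); lia.
have ip' : i != p.
  by apply/eqP=> e; have := le_p j jm; rewrite -e; lia.
apply: no312; exists p, i, j; split=> //; try lia.
by apply: le_p; lia.
Qed.

Lemma unimodal_no_213 m (s : 'S_m.+1) p : unimodal_at s p -> ~ orb_213 s.
Proof.
case=> pm up down [i [j [k [ij jk km H1 H2]]]].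
have [jp|pj] := leqP j p; first by have := up i j ij jp; lia.
by have := down j k (ltnW pj) jk km; lia.
Qed.

(** The decrease survives the shift of indices even at [j = m], since the cycle then returns to 0,
    below every other letter. *)
Lemma unimodal_step_down m (s : 'S_m.+1) p i j : cyclic_perm s ->
  unimodal_at s p -> p <= i -> i < j -> j < m.+1 -> orb s j.+1 < orb s i.+1.
Proof.
move=> cyc [pm up down] pi ij jm.
have [jm'|] := ltnP j.+1 m.+1; first by apply: down; lia.
move=> mj; have -> : j = m by lia.
by rewrite orb_period //; apply: orb_gt0 => //; lia.
Qed.

(* The two halves of a unimodal cycle form are each mapped increasingly, so the
   one-line notation is a union of two increasing sequences and avoids 321. *)
Lemma unimodal_no_4312 m (s : 'S_m.+1) p : cyclic_perm s ->
  unimodal_at s p -> ~ has_4312_or_4321 s.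
Proof.
move=> cyc un [x [y [z [_ [xy yz _ syx [szy _]]]]]].
have low i j : i < p -> j < p -> orb s i < orb s j -> orb s i.+1 < orb s j.+1.
  case: un => pm up down ip jp lt; have [|ji|e] := ltngtP i j.
  - by move=> ij; apply: up; lia.
  - by have := up j i ji (ltnW ip); lia.
  - by rewrite e ltnn in lt.
have high i j : p <= i -> p <= j -> i < m.+1 -> j < m.+1 ->
    orb s i < orb s j -> orb s i.+1 < orb s j.+1.
  move=> pi pj im jm lt; have [ij|ji|e] := ltngtP i j.
  - by case: un => _ _ /(_ i j pi ij jm); lia.
  - exact: (unimodal_step_down cyc un).
  - by rewrite e ltnn in lt.
have [i im Ei] := orb_surj cyc x; have [j jm Ej] := orb_surj cyc y.
have [k km Ek] := orb_surj cyc z.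
move: xy yz syx szy; rewrite Ei Ej Ek -!orbS => xy yz syx szy.
have xz := ltn_trans xy yz.
(* Two of the three indices lie on the same side of [p], which contradicts the descent of their
   images. *)
have := low i j; have := low i k; have := low j k.
have := high i j; have := high i k; have := high j k; lia.
Qed.

(** * A unimodal cycle form is determined by its ascents *)

Definition ascents n (s : 'S_n) : {set 'I_n} := [set x : 'I_n | x < s x].

(** An ascent is a letter followed by a larger one in the cycle form, so it lies before the peak.
    The last letter is followed by 0, and [0 < m] keeps it from being 0 itself. *)
Lemma orb_ascents m (s : 'S_m.+1) p i : 0 < m -> cyclic_perm s ->
  unimodal_at s p -> i < m.+1 -> (orb s i \in ascents s) = (i < p).
Proof.
move=> m0 cyc un im; rewrite inE -orbS; case: (un) => pm up down.
have [ip|pi] := ltnP i p; first by rewrite up.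
apply/negbTE; rewrite -leqNgt ltnW //.
have [im'|] := ltnP i.+1 m.+1; first exact: down.
move=> mi; have -> : i = m by lia.
by rewrite orb_period //; apply: orb_gt0; rewrite ?m0 ?ltnSn.
Qed.

(** As [enum] lists ordinals in increasing order, this rises through [A] and then falls through its
    complement, to which the peak is meant to belong. *)
Definition updown n (A : {set 'I_n}) : seq 'I_n := enum A ++ rev (enum (~: A)).

Definition ltord n : rel 'I_n := fun x y => x < y.

Lemma ltord_trans n : transitive (@ltord n).
Proof. by move=> y x z; apply: ltn_trans. Qed.

Lemma ltord_irr n : irreflexive (@ltord n).
Proof. by move=> x; apply: ltnn. Qed.

Lemma sorted_enum_ord n (A : {set 'I_n}) : sorted (@ltord n) (enum A).
Proof.
rewrite /enum_mem; apply: sorted_filter; first exact: ltord_trans.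
by rewrite -enumT; have := iota_ltn_sorted 0 n; rewrite -val_enum_ord sorted_map.
Qed.

Lemma nth_cat_rev (T : eqType) (r : rel T) (x0 : T) (l1 l2 : seq T) i j :
  transitive r -> sorted r l2 -> size l1 <= i -> i < j ->
  j < size (l1 ++ rev l2) -> r (nth x0 (l1 ++ rev l2) j) (nth x0 (l1 ++ rev l2) i).
Proof.
move=> r_tr srt li ij; rewrite size_cat size_rev => jl.
rewrite !nth_cat !ltnNge li (leq_trans li (ltnW ij)) /= !nth_rev; try lia.
by apply: (sorted_ltn_nth r_tr x0 srt); rewrite ?inE; lia.
Qed.

Lemma sorted_traject (T : Type) (f : T -> T) (r : rel T) x k :
  (forall i, i.+1 < k -> r (iter i f x) (iter i.+1 f x)) ->
  sorted r (traject f x k).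
Proof.
move=> H; apply/(sortedP x) => i; rewrite size_traject => ik.
by rewrite (nth_traject f ik) (nth_traject f (ltnW ik)); apply: H.
Qed.

(** Cut at [p], the trajectory has a sorted first part and a reverse-sorted second part, and a
    strictly sorted sequence is determined by its members. *)
Lemma traject_unimodal m (s : 'S_m.+1) p : 0 < m -> cyclic_perm s ->
  unimodal_at s p -> traject s ord0 m.+1 = updown (ascents s).
Proof.
move=> m0 cyc un; case: (un) => pm up down.
have asc := orb_ascents m0 cyc un.
have -> : traject s ord0 m.+1 = traject s ord0 (p + (m.+1 - p)).
  by congr traject; lia.
rewrite trajectD -/(orb s p); congr cat.
  apply: (irr_sorted_eq (@ltord_trans _) (@ltord_irr _)).
  - by apply: sorted_traject => i ip; apply: (up i i.+1 (ltnSn i)); lia.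
  - exact: sorted_enum_ord.
  move=> x; rewrite mem_enum; apply/trajectP/idP => [[i ip ->]|].
    by rewrite asc //; lia.
  by have [i im ->] := orb_surj cyc x; rewrite asc // => ip; exists i.
apply: (canRL revK).
apply: (irr_sorted_eq (@ltord_trans _) (@ltord_irr _)).
- rewrite rev_sorted; apply: sorted_traject => i ip.
  by rewrite !iter_orb; apply: (down (i + p) (i.+1 + p)); lia.
- exact: sorted_enum_ord.
move=> x; rewrite mem_rev mem_enum in_setC; apply/trajectP/idP => [[i ip ->]|].
  by rewrite iter_orb asc; lia.
have [i im ->] := orb_surj cyc x; rewrite asc // -leqNgt => ip.
by exists (i - p); rewrite ?iter_orb ?subnK //; lia.
Qed.

(** The trajectory gives the image of every letter but the last; the return to [ord0] gives that
    one. *)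
Lemma traject_inj m (s t : 'S_m.+1) : cyclic_perm s ->
  traject s ord0 m.+1 = traject t ord0 m.+1 -> iter m.+1 t ord0 = ord0 -> s = t.
Proof.
move=> cyc E Et.
have Ei i : i <= m.+1 -> orb s i = orb t i.
  rewrite leq_eqVlt => /orP[/eqP->|im]; first by rewrite orb_period.
  by have := congr1 (nth ord0 ^~ i) E; rewrite !nth_traject.
apply/permP=> x; have [i im ->] := orb_surj cyc x.
by rewrite {2}Ei 1?ltnW // -!orbS Ei.
Qed.

(** * The unimodal cyclic permutation with a prescribed set of ascents *)

Section SetToPerm.

Variables (m : nat) (A : {set 'I_m.+1}).
Hypotheses (A0 : ord0 \in A) (Amax : ord_max \notin A).

Lemma mem_updown x : x \in updown A.
Proof. by rewrite mem_cat mem_rev !mem_enum in_setC orbN. Qed.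

Lemma uniq_updown : uniq (updown A).
Proof.
rewrite cat_uniq rev_uniq !enum_uniq andbT /=.
by apply/hasPn=> x; rewrite mem_rev !mem_enum in_setC.
Qed.

Lemma size_updown : size (updown A) = m.+1.
Proof. by rewrite size_cat size_rev -!cardE cardsC card_ord. Qed.

(** Each letter goes to its cyclic successor in [updown A]; [prev] is the left inverse that gives
    injectivity. *)
Definition updown_perm : 'S_m.+1 := perm (can_inj (prev_next uniq_updown)).

Lemma nth_updown_low i j : i < j -> j < #|A| ->
  nth ord0 (updown A) i < nth ord0 (updown A) j.
Proof.
move=> ij jA; rewrite !nth_cat -cardE jA (ltn_trans ij jA).
apply: (sorted_ltn_nth (@ltord_trans _) ord0 (sorted_enum_ord A)) => //;
  rewrite inE -cardE //; exact: ltn_trans jA.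
Qed.

Lemma nth_updown_high i j : #|A| <= i -> i < j -> j < m.+1 ->
  nth ord0 (updown A) j < nth ord0 (updown A) i.
Proof.
rewrite cardE => Ai ij jm; have jl : j < size (updown A) by rewrite size_updown.
exact: (nth_cat_rev ord0 (@ltord_trans _) (sorted_enum_ord (~: A)) Ai ij jl).
Qed.

Lemma nth_updown0 : nth ord0 (updown A) 0 = ord0.
Proof.
have c0 : 0 < #|A| by apply/card_gt0P; exists ord0.
have H : ord0 \in enum A by rewrite mem_enum.
have iA : index ord0 (enum A) < #|A| by rewrite cardE index_mem.
have [i0|i0] := posnP (index ord0 (enum A)).
  by rewrite nth_cat -cardE c0 -{1}i0 nth_index.
(* If [ord0] were not first in the increasing part, some letter would be smaller than it. *)
have := nth_updown_low i0 iA.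
by rewrite [X in _ < nat_of_ord X]nth_cat -cardE iA nth_index.
Qed.

Lemma nth_updown_max : nth ord0 (updown A) #|A| = ord_max.
Proof.
have H : ord_max \in updown A := mem_updown _.
have Hn : nth ord0 (updown A) (index ord_max (updown A)) = ord_max by rewrite nth_index.
have := H; rewrite -index_mem size_updown => im.
have iA : #|A| <= index ord_max (updown A).
  rewrite leqNgt; apply/negP=> lt; move: Hn; rewrite nth_cat -cardE lt => e.
  by move: Amax; rewrite -e -mem_enum mem_nth // -cardE.
move: iA; rewrite leq_eqVlt => /orP[/eqP e|lt]; first by rewrite e.
have := nth_updown_high (leqnn _) lt im; rewrite Hn /=.
by rewrite ltnNge -ltnS ltn_ord.
Qed.

Lemma traject_updown_perm : traject updown_perm ord0 m.+1 = updown A /\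
  iter m.+1 updown_perm ord0 = ord0.
Proof.
(* [updown A] is a cycle of successors; opened at its first letter [ord0], it becomes a path of
   length [m.+1] back to [ord0]. *)
have := cycle_next uniq_updown; rewrite -(eq_fcycle (permE (can_inj (prev_next uniq_updown)))).
rewrite -/updown_perm; case E: (updown A) size_updown nth_updown0 => [//|x l] /= sz x0.
move/fpathP=> [k Ek]; have sk : k = m.+1.
  by have := congr1 size Ek; rewrite size_rcons size_traject sz => <-.
rewrite x0 {}sk in Ek *.
have : rcons (traject updown_perm ord0 m.+1) (iter m.+1 updown_perm ord0) = rcons (ord0 :: l) ord0.
  by rewrite -trajectSr /= Ek.
by move/rcons_inj=> [<- ->].
Qed.

Lemma orb_updown_perm i : i < m.+1 -> orb updown_perm i = nth ord0 (updown A) i.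
Proof.
by have [<- _] := traject_updown_perm => im; rewrite nth_traject.
Qed.

Lemma cyclic_updown_perm : cyclic_perm updown_perm.
Proof.
apply/cards1P; exists (porbit updown_perm ord0); apply/setP=> B; rewrite inE.
apply/imsetP/eqP=> [[x _ ->]|->]; last by exists ord0.
apply/eqP; rewrite eq_porbit_mem.
have := mem_updown x; have [<- _] := traject_updown_perm => /trajectP[i _ ->].
by rewrite -permX mem_porbit.
Qed.

Lemma unimodal_updown_perm : unimodal_at updown_perm #|A|.
Proof.
have cA : #|A| < m.+1.
  by have := max_card (mem (ord_max |: A)); rewrite cardsU1 Amax card_ord add1n.
split=> // [i j ij|i j Ai ij jm]; last first.
  by rewrite !orb_updown_perm ?nth_updown_high //; lia.
rewrite leq_eqVlt => /orP[/eqP ej|jA]; last first.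
  by rewrite !orb_updown_perm ?nth_updown_low //; lia.
(* In the remaining case [j] is the peak index, just past the letters of [A], and the letter there
   is [ord_max]. *)
have im : i < m.+1 by lia.
rewrite !orb_updown_perm // ej // nth_updown_max ltn_neqAle -ltnS ltn_ord andbT.
apply/eqP=> /val_inj; rewrite -nth_updown_max => /eqP.
rewrite nth_uniq ?uniq_updown ?size_updown // => /eqP; lia.
Qed.

Lemma ascents_updown_perm : 0 < m -> ascents updown_perm = A.
Proof.
move=> m0; apply/setP=> x; have [i im ->] := orb_surj cyclic_updown_perm x.
rewrite (orb_ascents m0 cyclic_updown_perm unimodal_updown_perm im).
rewrite orb_updown_perm // nth_cat -cardE; case: ltnP => iA.
  by rewrite -mem_enum mem_nth // -cardE.
have : nth ord0 (rev (enum (~: A))) (i - #|A|) \in rev (enum (~: A)).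
  apply: mem_nth; rewrite size_rev -cardE ltn_subLR //.
  by rewrite cardsC card_ord.
by rewrite mem_rev mem_enum in_setC => /negbTE.
Qed.

End SetToPerm.

(** * Counting *)

Lemma Aset_4312E m (s : 'S_m.+1) :
  s \in Aset m.+1 [:: [:: 4; 3; 1; 2]; [:: 4; 3; 2; 1]] [:: 2; 1; 3] <->
  [/\ cyclic_perm s, ~ has_4312_or_4321 s & ~ orb_213 s].
Proof.
rewrite inE /= andbT /avoids -negb_or.
split=> [/and3P[cyc /negP H1 /negP H2] | [cyc H1 H2]].
  split=> //; first by move/contains_4312E/orP.
  by move/(contains_213E cyc).
rewrite cyc /=; apply/andP; split; apply/negP.
  by move/orP/contains_4312E.
by move/(contains_213E cyc).
Qed.

Lemma Aset_3421E m (s : 'S_m.+1) :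
  s \in Aset m.+1 [:: [:: 3; 4; 2; 1]; [:: 4; 3; 2; 1]] [:: 3; 1; 2] <->
  [/\ cyclic_perm s, ~ has_3421_or_4321 s & ~ orb_312 s].
Proof.
rewrite inE /= andbT /avoids -negb_or.
split=> [/and3P[cyc /negP H1 /negP H2] | [cyc H1 H2]].
  split=> //; first by move/contains_3421E/orP.
  by move/(contains_312E cyc).
rewrite cyc /=; apply/andP; split; apply/negP.
  by move/orP/contains_3421E.
by move/(contains_312E cyc).
Qed.

Lemma Aset_3421V m (s : 'S_m.+1) :
  (s^-1%g \in Aset m.+1 [:: [:: 3; 4; 2; 1]; [:: 4; 3; 2; 1]] [:: 3; 1; 2]) =
  (s \in Aset m.+1 [:: [:: 4; 3; 1; 2]; [:: 4; 3; 2; 1]] [:: 2; 1; 3]).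
Proof.
apply/idP/idP=> [/Aset_3421E | /Aset_4312E] [cyc H1 H2].
  rewrite cyclic_permV in cyc; apply/Aset_4312E; split=> //.
    by move/has_3421V.
  by move/(orb_312V cyc).
apply/Aset_3421E; rewrite cyclic_permV; split=> //; first by move/has_3421V.
by move/(orb_312V cyc).
Qed.

(** Adjoining [ord0] is a bijection from the subsets of [D], the [k] letters other than the two
    extremes. *)
Lemma card_sets_0_nmax k :
  #|[set A : {set 'I_k.+2} | (ord0 \in A) && (ord_max \notin A)]| = 2 ^ k.
Proof.
set D : {set 'I_k.+2} := ~: [set ord0; ord_max].
have cD : #|D| = k by rewrite cardsCs setCK cards2 card_ord subn2.
rewrite -[in RHS]cD -card_powerset.
rewrite -(card_in_imset (f := fun B : {set 'I_k.+2} => ord0 |: B) (D := mem (powerset D))).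
  apply: eq_card => A; rewrite inE; apply/andP/imsetP => [[A0 Am]|[B]].
    exists (A :\ ord0); last by rewrite setD1K.
    rewrite inE; apply/subsetP=> x; rewrite !inE negb_or => /andP[-> xA] /=.
    by apply: contraNneq Am => <-.
  rewrite inE => /subsetP BD ->; rewrite !inE eqxx; split=> //.
  by rewrite negb_or /=; apply/negP=> /BD; rewrite !inE eqxx orbT.
move=> B C; rewrite !inE => /subsetP BD /subsetP CD E.
have n0 (X : {set 'I_k.+2}) : {subset X <= D} -> X = (ord0 |: X) :\ ord0.
  by move=> XD; rewrite setU1K //; apply/negP=> /XD; rewrite !inE eqxx.
by rewrite (n0 B) // (n0 C) // E.
Qed.

(** The map [ascents] is a bijection onto the sets just counted, with inverse [updown_perm]. *)
Lemma card_Aset_4312 k :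
  #|Aset k.+2 [:: [:: 4; 3; 1; 2]; [:: 4; 3; 2; 1]] [:: 2; 1; 3]| = 2 ^ k.
Proof.
have in_uni s : s \in Aset k.+2 [:: [:: 4; 3; 1; 2]; [:: 4; 3; 2; 1]] [:: 2; 1; 3] ->
    cyclic_perm s /\ exists p, unimodal_at s p.
  by move/Aset_4312E=> [cyc H1 H2]; split=> //; apply: avoiding_unimodal.
rewrite -card_sets_0_nmax -(card_in_imset (f := @ascents k.+2)).
  apply: eq_card => A; rewrite inE; apply/imsetP/andP=> [[s /in_uni[cyc [p un]] ->]|[A0 Am]].
    split; last by rewrite inE -leqNgt -ltnS ltn_ord.
    (* A peak at index 0 would put the letter at index 1 below 0. *)
    rewrite -[ord0]/(orb s 0) (orb_ascents _ cyc un) // lt0n; apply/eqP=> p0.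
    by case: un => _ _ /(_ 0 1); rewrite p0 => /(_ isT isT isT).
  exists (updown_perm A); last by rewrite ascents_updown_perm.
  have cyc := cyclic_updown_perm A0; have un := unimodal_updown_perm A0 Am.
  apply/Aset_4312E; split=> //; first exact: unimodal_no_4312 un.
  exact: unimodal_no_213 un.
move=> s t /in_uni[cs [p us]] /in_uni[ct [q ut]] E.
apply: traject_inj => //; last exact: orb_period.
by rewrite (traject_unimodal _ cs us) // (traject_unimodal _ ct ut) // E.
Qed.

Theorem theorem3p7 (n : nat) (hn : 2 <= n) :
  a_ n [:: [:: 4; 3; 1; 2]; [:: 4; 3; 2; 1]] [:: 2; 1; 3] = 2 ^ (n - 2) /\
  a_ n [:: [:: 3; 4; 2; 1]; [:: 4; 3; 2; 1]] [:: 3; 1; 2] = 2 ^ (n - 2).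
Proof.
case: n hn => [|[|k]] // _; rewrite subn2 /a_ -card_Aset_4312; split=> //.
(* The second class is the image of the first under inversion. *)
rewrite -[RHS](card_imset _ (@invg_inj _)); apply: eq_card => s.
by rewrite -[s]invgK Aset_3421V mem_imset //; apply: invg_inj.
Qed.
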